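(* Let $H$ be the graph of an instance of 3DSMI of size $n$ that has no stable matching. Construct an instance of 3DSM with graph $G$ as follows. The graph $H$ is a subgraph of $G$ with the same genders of vertices and the same ranks of edges. To each vertex $x\in V(H)$ attach its own copy $H_x$ of the gadget described in the context, consisting of the vertex $x$ itself and seven new vertices $a_x,b_x,c_x,d_x,e_x,s_x,t_x\notin V(H)$, where the subgraphs $H_x$, $x\in V(H)$, are pairwise disjoint, and where the parameter $r'_x$ of the gadget equals $\rho_H(x)+1$. The vertices of $G$ are exactly the vertices of $H$ together with all these new vertices. The ranks of all remaining edges of $G$ are defined arbitrarily (so that $G$ is the graph of an instance of 3DSM). Then the instance of 3DSM with graph $G$ has no stable matching, and its size equals $8n$.
   Context: **3DSMI and 3DSM.** An instance of 3DSMI of size $n$ is a directed graph $G$ without multiple edges whose vertex set $V(G)$ is partitioned into three sets (''genders'') $M,F,D$ with $|M|=|F|=|D|=n$, such that every edge goes from $M$ to $F$, from $F$ to $D$, or from $D$ to $M$. In the cyclic order $M\to F\to D\to M$ each gender has a ''next'' gender. Each edge $(v,v')$ carries a positive integer rank $r(v,v')$; for each vertex $v$ of outdegree $k$ the ranks of the edges going out of $v$ are exactly $1,\dots,k$, each used once (rank 1 is the best preference). An instance of 3DSM of size $n$ is an instance of 3DSMI in which every vertex is joined by an edge to all $n$ vertices of the next gender. **Matchings.** A family is a directed cycle of length 3 in $G$ (cyclic shifts are identified). A matching $\mu$ is a set of pairwise vertex-disjoint families. For a vertex $v$ belonging to a family of $\mu$, $\mu(v)$ denotes the vertex following $v$ in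 that family and $R_\mu(v)=r(v,\mu(v))$; otherwise $\mu(v)=v$ and $R_\mu(v)=+\infty$. A triple $(v,v',v'')$ forming a directed 3-cycle in $G$ is blocking for $\mu$ if $r(v,v')<R_\mu(v)$, $r(v',v'')<R_\mu(v')$ and $r(v'',v)<R_\mu(v'')$. The matching $\mu$ is stable if it has no blocking triple. **Notation.** For $v\in V(H)$, $\rho_H(v)=\max_{(v,v')\in E(H)} r(v,v')$ (and $\rho_H(v)=0$ if $v$ has no outgoing edge in $H$). **The gadget $H_x$.** It has the vertices $x,a,b,c,d,e,s,t$ (with subscript $x$ on the seven new ones). The vertices $e,s$ have the same gender as $x$; $c,d$ have the next gender after that of $x$; $a,b,t$ have the next gender after that of $c,d$. Its edges and their ranks are: rank 1: $(e,c),(c,a),(d,a),(a,x),(b,x),(t,e),(s,d)$; rank 2: $(t,s),(e,d),(c,b),(d,b),(a,e),(b,e)$; rank 3: $(b,s),(d,t)$; and $r(x,c)=r'_x$, $r(x,d)=r'_x+1$. *)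

(* Defs.v *)
From HB Require Import structures.
From mathcomp Require Import all_boot all_order all_algebra.

Set Implicit Arguments.
Unset Strict Implicit.
Unset Printing Implicit Defensive.

Import GRing.Theory.
Local Open Scope ring_scope.

(* The genders M, F, D are 0, 1, 2 in 'Z_3, so that the gender following g
   in the cyclic order M -> F -> D -> M is g + 1.
   The value rk v w is meaningful only when edge v w holds. *)
Record graph := Graph {
  vertex :> finType;
  gender : vertex -> 'Z_3;
  edge : rel vertex;
  rk : vertex -> vertex -> nat
}.

Definition cyclic_edges (G : graph) : Prop :=
  forall v w : G, edge v w -> gender w = gender v + 1.

Definition outdeg (G : graph) (v : G) : nat := #|[set w : G | edge v w]|.

Definition valid_ranks (G : graph) : Prop :=
  forall v : G,
    perm_eq [seq rk v w | w <- enum [set w : G | edge v w]]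
            (iota 1 (outdeg v)).

Definition is_3DSMI (n : nat) (G : graph) : Prop :=
  [/\ forall g : 'Z_3, #|[set v : G | gender v == g]| = n,
      cyclic_edges G
    & valid_ranks G].

Definition complete_edges (G : graph) : Prop :=
  forall v w : G, gender w = gender v + 1 -> edge v w.

Definition is_3DSM (n : nat) (G : graph) : Prop :=
  is_3DSMI n G /\ complete_edges G.

Section Matchings.
Variable G : graph.
Implicit Types (v w : G) (t : G * G * G) (mu : {set G * G * G}).

Definition cycle3 (v v' v'' : G) : bool :=
  [&& edge v v', edge v' v'' & edge v'' v].

(* Every directed 3-cycle has exactly one vertex of each gender; its class
   under cyclic shifts is represented by the shift that starts in M. *)
Definition family t : bool :=
  let: (v, v', v'') := t in (gender v == 0) && cycle3 v v' v''.

Definition members t : {set G} :=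
  let: (v, v', v'') := t in [set v; v'; v''].

Definition is_matching mu : Prop :=
  (forall t, t \in mu -> family t) /\
  (forall t t', t \in mu -> t' \in mu -> t != t' ->
     [disjoint members t & members t']).

Definition follows t v w : bool :=
  let: (u, u', u'') := t in
  [|| (v, w) == (u, u'), (v, w) == (u', u'') | (v, w) == (u'', u)].

Definition mate mu v : G :=
  odflt v [pick w | [exists t in mu, follows t v w]].

(* None stands for +oo. *)
Definition mate_rank mu v : option nat :=
  if [exists t in mu, v \in members t] then Some (rk v (mate mu v)) else None.

Definition better (k : nat) (R : option nat) : bool :=
  if R is Some m then (k < m)%N else true.

Definition blocking mu (v v' v'' : G) : bool :=
  [&& cycle3 v v' v'',
      better (rk v v') (mate_rank mu v),
      better (rk v' v'') (mate_rank mu v')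
    & better (rk v'' v) (mate_rank mu v'')].

Definition stable mu : Prop :=
  is_matching mu /\ forall v v' v'', ~~ blocking mu v v' v''.

End Matchings.

Definition has_stable_matching (G : graph) : Prop :=
  exists mu : {set G * G * G}, stable mu.

Definition rho (H : graph) (v : H) : nat := (\max_(w : H | edge v w) rk v w)%N.

Definition subgraph_via (K G : graph) (f : K -> G) : Prop :=
  [/\ injective f,
      forall v, gender (f v) = gender v
    & forall v w, edge v w -> edge (f v) (f w) /\ rk (f v) (f w) = rk v w].

Inductive gadget_vertex := gx | ga | gb | gc | gd | ge | gs | gt.

Definition gadget_code (i : gadget_vertex) : 'I_8 :=
  inord match i with
  | gx => 0 | ga => 1 | gb => 2 | gc => 3 | gd => 4 | ge => 5 | gs => 6 | gt => 7
  end.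

Definition gadget_decode (i : 'I_8) : gadget_vertex :=
  nth gx [:: gx; ga; gb; gc; gd; ge; gs; gt] i.

Lemma gadget_codeK : cancel gadget_code gadget_decode.
Proof. by case; rewrite /gadget_code /gadget_decode inordK. Qed.

HB.instance Definition _ := Finite.copy gadget_vertex (can_type gadget_codeK).

Definition gadget_gender (g : 'Z_3) (i : gadget_vertex) : 'Z_3 :=
  match i with
  | gx | ge | gs => g
  | gc | gd => g + 1
  | ga | gb | gt => g + 2
  end.

Definition gadget_rank (r' : nat) (i j : gadget_vertex) : option nat :=
  match i, j with
  | ge, gc | gc, ga | gd, ga | ga, gx | gb, gx | gt, ge | gs, gd => Some 1
  | gt, gs | ge, gd | gc, gb | gd, gb | ga, ge | gb, ge => Some 2
  | gb, gs | gd, gt => Some 3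
  | gx, gc => Some r'
  | gx, gd => Some r'.+1
  | _, _ => None
  end%N.

(* The gadget H_x for a vertex x of gender g. *)
Definition gadget (g : 'Z_3) (r' : nat) : graph :=
  @Graph gadget_vertex (gadget_gender g)
    (fun i j => isSome (gadget_rank r' i j))
    (fun i j => odflt 0%N (gadget_rank r' i j)).

(* The graphs G obtained from H by the construction: phi x i is the vertex i
   of the copy H_x, and the vertex x of H itself is phi x gx. Bijectivity says
   that the copies are disjoint and exhaust V(G). The last three conditions
   are those of an instance of 3DSM, except for the equality of the numbers
   of vertices of the three genders, which is not assumed. *)
Record gadget_extension (H G : graph) (phi : H -> gadget_vertex -> G) : Prop := {
  ext_bij : bijective (fun p : H * gadget_vertex => phi p.1 p.2);
  ext_sub : subgraph_via (fun x : H => phi x gx);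
  ext_gadget : forall x : H,
    @subgraph_via (gadget (gender x) (rho x).+1) G (phi x);
  ext_cyclic : cyclic_edges G;
  ext_complete : complete_edges G;
  ext_ranks : valid_ranks G
}.

(* Main.v *)
Require Import Defs.
From mathcomp Require Import all_boot all_order all_algebra.

(** Each of the eight gadget vertices replicates [H], up to a rotation of the
    genders, so [G] has size [8 * n]. For the other claim, a stable matching
    [mu] of [G] is turned into a stable matching of [H] by keeping the families
    of [mu] that lie inside [H].

    The gadget makes this work. Fix a vertex [x] of [H] whose rank in [mu] is
    worse than [rho x]. The vertices of the gadget rank the gadget edges above
    all their other edges, and so does [x] among the ranks above [rho x]. Since
    no 3-cycle of the gadget is blocking, each of them has a vertex that [mu]
    sends along a gadget edge at least as good as its edge in the cycle. Playing
    a few of these cycles against each other ([gadget_predecessor]) shows that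
    [mu] sends another vertex of the gadget to [x]. Consequently
    ([rank_le_rho_or_gadget_predecessor]) a vertex of [H] whose predecessor in
    [mu] is a vertex of [H] has rank at most [rho]; its successor is then
    reached by an edge of [H], because the edges of [H] use up all these ranks.

    This propagates along families ([family_in_H]): if [x] has rank at most
    [rho x], then its successor lies in [H] and has a predecessor in [H], so the
    same holds for the successor, and the whole family of [x] lies in [H].
    Therefore a vertex of [H] that does at least as well in [mu] as some edge
    of [H] keeps its family ([rank_le_restricted]), and a triple of [H] that
    blocks the kept families would block [mu] in [G]. *)

Set Implicit Arguments.
Unset Strict Implicit.
Unset Printing Implicit Defensive.

Import GRing.Theory.

(** * Ranks *)

Section Ranks.
Variable G : graph.
Hypothesis ranksG : valid_ranks G.
Implicit Types v w : G.

Lemma rk_bounds v w : edge v w -> 0 < rk v w <= outdeg v.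
Proof.
move=> vw; have: rk v w \in iota 1 (outdeg v).
  by rewrite -(perm_mem (ranksG v)) map_f // mem_enum inE.
by rewrite mem_iota add1n ltnS.
Qed.

Lemma rk_inj v w w' : edge v w -> edge v w' -> rk v w = rk v w' -> w = w'.
Proof.
move=> vw vw'; have/dinjectiveP: dinjectiveb (rk v) [set u | edge v u].
  by rewrite /dinjectiveb (perm_uniq (ranksG v)) iota_uniq.
by apply; rewrite inE.
Qed.

Lemma rk_surj v m : 0 < m <= outdeg v -> exists2 w, edge v w & rk v w = m.
Proof.
move=> m_in; have: m \in iota 1 (outdeg v) by rewrite mem_iota add1n ltnS.
rewrite -(perm_mem (ranksG v)).
by case/mapP=> w; rewrite mem_enum inE => vw ->; exists w.
Qed.

Lemma rk_le_rho v w : edge v w -> rk v w <= rho v.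
Proof. by move=> vw; rewrite /rho (bigD1 w) //= leq_maxl. Qed.

Lemma rho_le_outdeg v : rho v <= outdeg v.
Proof. by apply/bigmax_leqP => w /rk_bounds/andP[]. Qed.

End Ranks.

(** * Matchings as successor relations *)

Section Successors.
Variables (G : graph) (mu : {set G * G * G}).
Hypotheses (cyclicG : cyclic_edges G) (mu_matching : is_matching mu).
Implicit Types (v w u : G).

Definition succ_in v w : bool := [exists t in mu, follows t v w].

(** This is [R_mu(v) <= k], with the rank [+oo] of unmatched vertices encoded by
    the absence of a successor; [better_mate_rank] is the link with
    [mate_rank]. *)
Definition rank_le v k : bool := [exists w, succ_in v w && (rk v w <= k)].

Lemma edge_neq v w : edge v w -> v != w.
Proof.
move/cyclicG => vw; apply/eqP => eq_vw; move: vw; rewrite -eq_vw.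
by move/eqP; rewrite -subr_eq0 opprD addrA subrr.
Qed.

Lemma follows_members t v w : follows t v w -> v \in members t.
Proof.
by case: t => [[x y] z]; rewrite /= !inE => /or3P[]/eqP[-> _]; rewrite eqxx ?orbT.
Qed.

(** The families of a matching are stored as triples that start at a vertex of
    gender 0, hence the three possible positions of [v]. *)
Lemma succ_in_third v w : succ_in v w ->
  exists u, [/\ cycle3 v w u, succ_in w u, succ_in u v &
             [|| (v, w, u) \in mu, (w, u, v) \in mu | (u, v, w) \in mu]].
Proof.
case/exists_inP=> -[[x y] z] t_mu /= fol.
have /andP[_ /and3P[xy yz zx]] := mu_matching.1 _ t_mu.
have in_mu p q : follows (x, y, z) p q -> succ_in p q.
  by move=> pq; apply/exists_inP; exists (x, y, z).
case/or3P: fol => /eqP[-> ->]; [exists z | exists x | exists y];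
  by rewrite /cycle3 xy yz zx t_mu ?orbT; split=> //; apply: in_mu; rewrite /= eqxx ?orbT.
Qed.

Lemma succ_in_edge v w : succ_in v w -> edge v w.
Proof. by case/succ_in_third=> u [/and3P[]]. Qed.

Lemma succ_in_functional v w w' : succ_in v w -> succ_in v w' -> w = w'.
Proof.
case/exists_inP=> t t_mu fol /exists_inP[t' t'_mu fol'].
have eq_t: t' = t.
  apply/eqP; case: eqVneq => // neq_t.
  have /pred0P/(_ v) := mu_matching.2 _ _ t'_mu t_mu neq_t.
  by rewrite /= (follows_members fol) (follows_members fol').
move: t_mu fol fol'; rewrite {t' t'_mu}eq_t; case: t => [[x y] z] t_mu /=.
have /andP[_ /and3P[/edge_neq xy /edge_neq yz /edge_neq zx]] := mu_matching.1 _ t_mu.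
rewrite !xpair_eqE.
by case/or3P=> /andP[/eqP-> /eqP->] /or3P[]/andP[/eqP eq_x /eqP->] //; move: xy yz zx; rewrite eq_x eqxx.
Qed.

(** In a family the predecessor is the successor of the successor, so
    injectivity follows from functionality. *)
Lemma succ_in_injective v v' w : succ_in v w -> succ_in v' w -> v = v'.
Proof.
case/succ_in_third=> u [_ wu uv _] /succ_in_third[u' [_ wu' uv' _]].
by rewrite -(succ_in_functional wu wu') in uv'; apply: succ_in_functional uv uv'.
Qed.

Lemma better_mate_rank v k : better k (mate_rank mu v) = ~~ rank_le v k.
Proof.
rewrite /mate_rank /mate; case: exists_inP => [[t t_mu v_t]|no_t] /=.
  case: pickP => [w vw | no_w] /=.
    rewrite ltnNge; congr (~~ _); apply/idP/existsP => [le_k|[w' /andP[vw']]].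
      by exists w; rewrite [succ_in v w]vw.
    by rewrite (succ_in_functional (vw : succ_in v w) vw').
  have [w vw]: exists w, follows t v w.
    case: t v_t {t_mu} => [[x y] z]; rewrite /= !inE -orbA.
    by case/or3P=> /eqP->; [exists y | exists z | exists x]; rewrite eqxx ?orbT.
  by case/existsP: (no_w w); exists t; rewrite t_mu.
apply/esym/existsPn => w; apply/negP => /andP[/exists_inP[t t_mu vw] _].
by case: no_t; exists t => //; apply: follows_members vw.
Qed.

Lemma stableP :
  stable mu <-> forall v v' v'', cycle3 v v' v'' ->
    [|| rank_le v (rk v v'), rank_le v' (rk v' v'') | rank_le v'' (rk v'' v)].
Proof.
have blockingE v v' v'': ~~ blocking mu v v' v'' = (cycle3 v v' v'' ==>
    [|| rank_le v (rk v v'), rank_le v' (rk v' v'') | rank_le v'' (rk v'' v)]).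
  by rewrite /blocking !better_mate_rank -!negb_or; case: cycle3 => //=; rewrite negbK.
split=> [[_ st] v v' v'' | st]; first by apply/implyP; rewrite -blockingE.
by split=> // v v' v''; rewrite blockingE; apply/implyP/st.
Qed.

End Successors.

(** * The gadget *)

(** The ranks of the gadget edges out of a vertex are an initial segment of
    the ranks, except that those out of [x] start at [r']. *)
Lemma gadget_rank_initial (r' m : nat) (i j : gadget_vertex) (k : nat) :
    gadget_rank r' i j = Some k -> 0 < m <= k -> (i = gx -> r' <= m) ->
  exists j', gadget_rank r' i j' = Some m.
Proof.
have at_x: r' <= m <= r'.+1 -> exists j', gadget_rank r' gx j' = Some m.
  case/andP=> r'_le; rewrite leq_eqVlt ltnS => /orP[/eqP->|le_r']; first by exists gd.
  by exists gc; congr Some; apply/anti_leq/andP.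
case: i => [|||||||] eq_k /andP[m_gt0 m_le] r'_le.
  apply: at_x; rewrite r'_le //=; apply: leq_trans m_le _.
  by case: j eq_k => //= -[<-].
all: case: j eq_k => //= -[eq_k]; move: m_gt0 m_le; rewrite -{}eq_k.
all: case: m r'_le {at_x} => [|[|[|[|m]]]] //= _ _ _.
all: by [exists ga | exists gb | exists gc | exists gd | exists ge | exists gs
        | exists gt | exists gx].
Qed.

(** The shape of [rank_le] seen from inside the gadget, for a matching that
    sends [i] to [j] exactly when [P i j]; vertices that it sends outside the
    gadget have no [P]-successor. *)
Definition at_least_in_gadget (r' : nat) (P : rel gadget_vertex) i j : Prop :=
  exists k l m,
    [/\ P i k, gadget_rank r' i k = Some l, gadget_rank r' i j = Some m & l <= m].

(* Lists the edges that are at least as good as a given one. *)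
Ltac list_better_edges := by case=> -[] [l [m []]] //= Pij [<-] [<-] //; tauto.

(** Suppose that none of [a], [b], [t] is sent to [x]. If [x] is sent to [c],
    the cycles [e, c, a] and [e, c, b] force both [a] and [b] to be sent to [e].
    Otherwise the cycles [x, c, a] and [x, d, a] force [c] to be sent to [a] and
    [x] to [d]; the cycle [e, d, a] then forces [a] to be sent to [e], after
    which the cycles [s, d, b] and [s, d, t] force both [b] and [t] to be sent
    to [s]. *)
Lemma gadget_predecessor (r' : nat) (g : 'Z_3) (P : rel gadget_vertex) :
    (forall i j k, P i k -> P j k -> i = j) ->
    (forall i j k, P i j -> P j k -> P k i) ->
    let at_least := at_least_in_gadget r' P in
    (forall i j k : gadget g r', cycle3 i j k ->
       at_least i j \/ at_least j k \/ at_least k i) ->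
  exists2 i, i <> gx & P i gx.
Proof.
move=> Pl P3 at_least unblocked.
have [ax|/negP ax] := boolP (P ga gx); first by exists ga.
have [bx|/negP bx] := boolP (P gb gx); first by exists gb.
have [tx|/negP tx] := boolP (P gt gx); first by exists gt.
exfalso.
have xc : at_least gx gc -> P gx gc.
  by case=> -[] [l [m []]] //= Pij [<-] [<-]; rewrite ?ltnn.
have xd : at_least gx gd -> P gx gc \/ P gx gd by list_better_edges.
have ec : at_least ge gc -> P ge gc by list_better_edges.
have ed : at_least ge gd -> P ge gc \/ P ge gd by list_better_edges.
have sd : at_least gs gd -> P gs gd by list_better_edges.
have ca : at_least gc ga -> P gc ga by list_better_edges.
have cb : at_least gc gb -> P gc ga \/ P gc gb by list_better_edges.
have da : at_least gd ga -> P gd ga by list_better_edges.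
have db : at_least gd gb -> P gd ga \/ P gd gb by list_better_edges.
have dt : at_least gd gt -> P gd ga \/ P gd gb \/ P gd gt by list_better_edges.
have ax' : ~ at_least ga gx by list_better_edges.
have ae : at_least ga ge -> P ga ge by list_better_edges.
have be : at_least gb ge -> P gb ge by list_better_edges.
have bs : at_least gb gs -> P gb ge \/ P gb gs by list_better_edges.
have ts : at_least gt gs -> P gt ge \/ P gt gs by list_better_edges.
have [x_c|not_xc] : P gx gc \/ ~ P gx gc by case: (P gx gc); [left | right].
  have not_ca: ~ P gc ga by move=> /(P3 _ _ _ x_c).
  have not_cb: ~ P gc gb by move=> /(P3 _ _ _ x_c).
  have not_ec: ~ P ge gc by move=> /(Pl _ _ _ x_c).
  have a_e: P ga ge by have := unblocked ge gc ga isT; tauto.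
  have b_e: P gb ge by have := unblocked ge gc gb isT; tauto.
  by have := Pl _ _ _ a_e b_e.
have c_a: P gc ga by have := unblocked gx gc ga isT; tauto.
have not_da: ~ P gd ga by move=> /(Pl _ _ _ c_a).
have x_d: P gx gd by have := unblocked gx gd ga isT; tauto.
have not_db: ~ P gd gb by move=> /(P3 _ _ _ x_d).
have not_dt: ~ P gd gt by move=> /(P3 _ _ _ x_d).
have not_ed: ~ P ge gd by move=> /(Pl _ _ _ x_d).
have not_sd: ~ P gs gd by move=> /(Pl _ _ _ x_d).
have a_e: P ga ge.
  have ec_ae: P ge gc -> P ga ge by move=> /P3; apply.
  by have := unblocked ge gd ga isT; tauto.
have not_be: ~ P gb ge by move=> /(Pl _ _ _ a_e).
have not_te: ~ P gt ge by move=> /(Pl _ _ _ a_e).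
have b_s: P gb gs by have := unblocked gs gd gb isT; tauto.
have t_s: P gt gs by have := unblocked gs gd gt isT; tauto.
by have := Pl _ _ _ b_s t_s.
Qed.

(** * The extension *)

Section Extension.
Variables (H G : graph) (phi : H -> gadget_vertex -> G).
Hypotheses (ranksH : valid_ranks H) (extG : gadget_extension phi).

Let ranksG : valid_ranks G := ext_ranks extG.
Let cyclicG : cyclic_edges G := ext_cyclic extG.

Lemma phi_inj x y i j : phi x i = phi y j -> x = y /\ i = j.
Proof. by move=> eq_phi; have [-> ->] := @bij_inj _ _ _ (ext_bij extG) (x, i) (y, j) eq_phi. Qed.

Lemma phi_gadget_edge x i j k : gadget_rank (rho x).+1 i j = Some k ->
  edge (phi x i) (phi x j) /\ rk (phi x i) (phi x j) = k.
Proof.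
move=> ij; have [_ _ /(_ i j)/=] := ext_gadget extG x.
by rewrite ij => /(_ isT).
Qed.

(** The edges of [H] already take all the ranks up to [rho x]. *)
Lemma rk_le_rho_edge x w : edge (phi x gx) w -> rk (phi x gx) w <= rho x ->
  exists2 y, w = phi y gx & edge x y.
Proof.
move=> xw w_le; have [_ _ subH] := ext_sub extG.
have /andP[rk_gt0 _] := rk_bounds ranksG xw.
have [|y xy rk_xy] := rk_surj ranksH (v := x) (m := rk (phi x gx) w).
  by rewrite rk_gt0 (leq_trans w_le) ?rho_le_outdeg.
have [xy' rk_xy'] := subH _ _ xy.
by exists y => //; apply: (rk_inj ranksG xw xy'); rewrite rk_xy' rk_xy.
Qed.

(** A vertex of the gadget can do at least as well as with one of its gadget
    edges only by using a gadget edge; for [x] itself the edges of [H] have to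
    be excluded. *)
Lemma gadget_edge_better x i j k w : gadget_rank (rho x).+1 i j = Some k ->
    edge (phi x i) w -> rk (phi x i) w <= k ->
    (i = gx -> rho x < rk (phi x i) w) ->
  exists2 j', w = phi x j' & gadget_rank (rho x).+1 i j' = Some (rk (phi x i) w).
Proof.
move=> ij iw w_le far; have /andP[rk_gt0 _] := rk_bounds ranksG iw.
have [|j' ij'] := gadget_rank_initial ij _ far; first by rewrite rk_gt0.
have [iw' rk_iw'] := phi_gadget_edge ij'.
by exists j' => //; apply: (rk_inj ranksG iw iw'); rewrite rk_iw'.
Qed.

(** * From a stable matching of the extension to one of the original instance *)

Section StableMatching.
Variable mu : {set G * G * G}.
Hypothesis stable_mu : stable mu.

Let mu_matching : is_matching mu := proj1 stable_mu.
Notation next := (succ_in mu).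

Lemma rank_le_rho_or_gadget_predecessor x :
  rank_le mu (phi x gx) (rho x) \/ exists2 i, i <> gx & next (phi x i) (phi x gx).
Proof.
case: (boolP (rank_le mu (phi x gx) (rho x))) => [|/existsPn far]; first by left.
right; set r' := (rho x).+1.
have settled i j : edge (i : gadget (gender x) r') j ->
    rank_le mu (phi x i) (rk (phi x i) (phi x j)) ->
  at_least_in_gadget r' (fun i j => next (phi x i) (phi x j)) i j.
  rewrite /=; case ij: (gadget_rank r' i j) => [k|//] _.
  have [_ ->] := phi_gadget_edge ij.
  case/existsP=> w /andP[iw w_le].
  have iw_edge := succ_in_edge mu_matching iw.
  have [|j' def_w ij'] := gadget_edge_better ij iw_edge w_le.
    by move=> def_i; have := far w; rewrite -def_i iw ltnNge.
  by exists j', (rk (phi x i) w), k; rewrite -def_w.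
apply: (@gadget_predecessor r' (gender x) (fun i j => next (phi x i) (phi x j))).
- move=> i j k ik jk.
  by have [] := phi_inj (succ_in_injective cyclicG mu_matching ik jk).
- move=> i j k ij jk.
  have [u [_ ju ui _]] := succ_in_third mu_matching ij.
  by rewrite (succ_in_functional cyclicG mu_matching jk ju).
move=> i j k /and3P[ij jk ki].
have [_ _ sub] := ext_gadget extG x.
have := (stableP cyclicG mu_matching).1 stable_mu (phi x i) (phi x j) (phi x k).
case/(_ _)/or3P=> [|/settled|/settled|/settled]; try by auto.
by apply/and3P; split; [apply: (sub i j _).1 | apply: (sub j k _).1 | apply: (sub k i _).1].
Qed.

(** The predecessor [x] of [y] cannot also be a new vertex of the gadget of
    [y]. *)
Lemma succ_in_H x y : next (phi x gx) (phi y gx) -> rank_le mu (phi y gx) (rho y).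
Proof.
move=> xy; case: (rank_le_rho_or_gadget_predecessor y) => // -[i neq_i iy].
by have [_ /esym] := phi_inj (succ_in_injective cyclicG mu_matching xy iy).
Qed.

Lemma rank_le_rho_succ x : rank_le mu (phi x gx) (rho x) ->
  exists2 y, edge x y & next (phi x gx) (phi y gx).
Proof.
case/existsP=> w /andP[xw w_le].
have [y def_w xy] := rk_le_rho_edge (succ_in_edge mu_matching xw) w_le.
by exists y; rewrite -?def_w.
Qed.

(** The property of having rank at most [rho] passes from a vertex of [H] to
    its successor, hence around the whole family. *)
Lemma family_in_H x w : next (phi x gx) w -> rk (phi x gx) w <= rho x ->
  exists y z, [/\ w = phi y gx, cycle3 x y z &
    [|| (phi x gx, phi y gx, phi z gx) \in mu,
        (phi y gx, phi z gx, phi x gx) \in mu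
      | (phi z gx, phi x gx, phi y gx) \in mu]].
Proof.
move=> xw w_le; have [|y xy x_y] := @rank_le_rho_succ x.
  by apply/existsP; exists w; rewrite xw.
have [z yz y_z] := rank_le_rho_succ (succ_in_H x_y).
have [x' zx' z_x'] := rank_le_rho_succ (succ_in_H y_z).
have [u [_ y_u u_x mem_mu]] := succ_in_third mu_matching x_y.
have def_u := succ_in_functional cyclicG mu_matching y_u y_z; subst u.
have [def_x' _] := phi_inj (succ_in_functional cyclicG mu_matching u_x z_x'); subst x'.
by exists y, z; rewrite (succ_in_functional cyclicG mu_matching xw x_y) /cycle3 xy yz zx'.
Qed.

Definition phi_triple (t : H * H * H) : G * G * G :=
  (phi t.1.1 gx, phi t.1.2 gx, phi t.2 gx).

Definition restricted_matching : {set H * H * H} :=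
  [set t | Defs.family t & phi_triple t \in mu].

Lemma restricted_matching_ok : is_matching restricted_matching.
Proof.
split=> [t | t t']; first by rewrite inE => /andP[].
rewrite !inE => /andP[_ t_mu] /andP[_ t'_mu] neq_t.
have phi_members u v : v \in members u -> phi v gx \in members (phi_triple u).
  by case: u => [[a b] c]; rewrite /= !inE -!orbA => /or3P[]/eqP->; rewrite eqxx ?orbT.
have neq_phi: phi_triple t != phi_triple t'.
  apply: contra neq_t => /eqP[]; case: t t' {t_mu t'_mu} => [[a b] c] [[a' b'] c'] /=.
  by move=> /phi_inj[-> _] /phi_inj[-> _] /phi_inj[-> _].
have /pred0P disj := mu_matching.2 _ _ t_mu t'_mu neq_phi.
apply/pred0P=> v /=; apply/negP => /andP[/phi_members v_t /phi_members v_t'].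
by have := disj (phi v gx); rewrite /= v_t v_t'.
Qed.

(** The converse of the obvious comparison between [mu] and its restriction:
    discarding families does not harm the vertices that do well in [mu]. *)
Lemma rank_le_restricted x k : k <= rho x ->
  rank_le mu (phi x gx) k -> rank_le restricted_matching x k.
Proof.
move=> k_le /existsP[w /andP[xw w_le]].
have [y [z [def_w cyc mem_mu]]] := family_in_H xw (leq_trans w_le k_le).
have [xy yz zx] := and3P cyc.
have [_ gender_phi /(_ _ _ xy)[_ rk_xy]] := ext_sub extG.
apply/existsP; exists y; rewrite -rk_xy -def_w w_le andbT.
have family_phi t : phi_triple t \in mu -> cycle3 t.1.1 t.1.2 t.2 ->
    t \in restricted_matching.
  move=> t_mu cyc_t; rewrite inE t_mu andbT; have := mu_matching.1 _ t_mu.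
  by case: t t_mu cyc_t => [[a b] c] /= _ -> /andP[+ _]; rewrite gender_phi => ->.
apply/exists_inP; case/or3P: mem_mu => mem_mu.
- by exists (x, y, z); [apply: family_phi | rewrite /= eqxx].
- exists (y, z, x); [apply: family_phi => //=|by rewrite /= eqxx !orbT].
  by rewrite /cycle3 xy yz zx.
- exists (z, x, y); [apply: family_phi => //=|by rewrite /= eqxx !orbT].
  by rewrite /cycle3 xy yz zx.
Qed.

Lemma restricted_matching_stable : cyclic_edges H -> stable restricted_matching.
Proof.
move=> cyclicH; apply/(stableP cyclicH restricted_matching_ok) => x y z cyc.
have [xy yz zx] := and3P cyc; have [_ _ sub] := ext_sub extG.
have [xy' rk_xy] := sub _ _ xy; have [yz' rk_yz] := sub _ _ yz.
have [zx' rk_zx] := sub _ _ zx.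
have := (stableP cyclicG mu_matching).1 stable_mu (phi x gx) (phi y gx) (phi z gx).
rewrite /cycle3 xy' yz' zx' rk_xy rk_yz rk_zx => /(_ isT).
case/or3P=> /rank_le_restricted-> //; rewrite ?orbT //; exact: rk_le_rho.
Qed.

End StableMatching.

(** * Size *)

Lemma card_gadget_vertex : #|{: gadget_vertex}| = 8.
Proof.
rewrite -[RHS]card_ord; apply: (bij_eq_card (f := gadget_code)).
exists gadget_decode; first exact: gadget_codeK.
by case=> -[|[|[|[|[|[|[|[|//]]]]]]]] lt8; apply: val_inj; rewrite /= inordK.
Qed.

(** Reading off the gender [0] gives the rotation of genders from [x] to the
    vertex [i] of its gadget. *)
Definition gadget_shift (i : gadget_vertex) : 'Z_3 := gadget_gender 0%R i.

Lemma gadget_genderE g i : gadget_gender g i = (g + gadget_shift i)%R.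
Proof. by case: i; rewrite /gadget_shift /= ?addr0 ?add0r. Qed.

Lemma card_gender n g : (forall g' : 'Z_3, #|[set x : H | gender x == g']| = n) ->
  #|[set v : G | gender v == g]| = 8 * n.
Proof.
move=> cardH; rewrite -card_gadget_vertex -sum_nat_const -sum1_card.
rewrite (reindex _ (onW_bij _ (ext_bij extG))) /=.
transitivity (\sum_(i : gadget_vertex) \sum_(x : H | gender x == (g - gadget_shift i)%R) 1).
  rewrite (exchange_big_dep predT) //= pair_big_dep /=.
  apply: eq_bigl => -[x i]; rewrite inE /=.
  have [_ gender_phi _] := ext_gadget extG x.
  by rewrite gender_phi /= gadget_genderE -subr_eq opprK.
apply: eq_bigr => i _; rewrite -(cardH (g - gadget_shift i)%R) -sum1_card.
by apply: eq_bigl => x; rewrite inE.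
Qed.

End Extension.

Theorem theorem1 (n : nat) (H G : graph) (phi : H -> gadget_vertex -> G)
    (instH : is_3DSMI n H)
    (unstableH : ~ has_stable_matching H)
    (extG : gadget_extension phi) :
  is_3DSM (8 * n) G /\ ~ has_stable_matching G.
Proof.
have [cardH cyclicH ranksH] := instH; split.
  split; last exact: ext_complete extG.
  split; [|exact: ext_cyclic extG|exact: ext_ranks extG].
  by move=> g; exact: (card_gender extG).
case=> mu stable_mu; apply: unstableH.
exists (restricted_matching phi mu); exact: restricted_matching_stable.
Qed.
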